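(* Let $A,B,C$ be the vertices of a non-degenerate triangle in the Euclidean plane, and suppose that $\triangle ABC$ is not equilateral. Let $D$ be the intersection of the line through $B$ perpendicular to $AC$ with the perpendicular bisector of $AB$; let $E$ be the intersection of the line through $C$ perpendicular to $AB$ with the perpendicular bisector of $BC$; and let $F$ be the intersection of the line through $A$ perpendicular to $BC$ with the perpendicular bisector of $AC$. Then $\triangle ABC$ and $\triangle DEF$ are similar.
   Context: Similarity of triangles is with vertices corresponding in the order written ($A\leftrightarrow D$, $B\leftrightarrow E$, $C\leftrightarrow F$) and may reverse orientation. *)

(* Defs.v *)
From mathcomp Require Import all_boot all_order all_algebra.
From mathcomp Require Import classical_sets reals.
Set Implicit Arguments.
Unset Strict Implicit.
Unset Printing Implicit Defensive.
Import Order.TTheory GRing.Theory Num.Theory.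
Local Open Scope classical_set_scope.
Local Open Scope ring_scope.

(* The Euclidean plane is 'rV[R]_2. The library norm on 'rV[R]_2 is the sup norm, hence an explicit Euclidean
   inner product and distance. *)
Definition dot (R : realType) (u v : 'rV[R]_2) : R :=
  \sum_(i < 2) u 0 i * v 0 i.

Definition dist (R : realType) (P Q : 'rV[R]_2) : R :=
  Num.sqrt (dot (Q - P) (Q - P)).

Definition line (R : realType) (P Q : 'rV[R]_2) : set 'rV[R]_2 :=
  [set X | exists t : R, X = P + t *: (Q - P)].

Definition collinear (R : realType) (A B C : 'rV[R]_2) : Prop :=
  exists P Q : 'rV[R]_2, [/\ P <> Q, line P Q A, line P Q B & line P Q C].

Definition equilateral (R : realType) (A B C : 'rV[R]_2) : Prop :=
  dist A B = dist B C /\ dist B C = dist C A.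

(* The line through P perpendicular to the line QS; a line only if Q <> S. *)
Definition perp_line (R : realType) (P Q S : 'rV[R]_2) : set 'rV[R]_2 :=
  [set X | dot (X - P) (S - Q) = 0].

Definition midpoint (R : realType) (P Q : 'rV[R]_2) : 'rV[R]_2 :=
  2^-1 *: (P + Q).

Definition perp_bisector (R : realType) (P Q : 'rV[R]_2) : set 'rV[R]_2 :=
  perp_line (midpoint P Q) P Q.

(* Similarities of either orientation. *)
Definition similarity (R : realType) (k : R) (f : 'rV[R]_2 -> 'rV[R]_2) : Prop :=
  0 < k /\ forall P Q : 'rV[R]_2, dist (f P) (f Q) = k * dist P Q.

Definition similar_triangles (R : realType) (A B C D E F : 'rV[R]_2) : Prop :=
  exists (k : R) (f : 'rV[R]_2 -> 'rV[R]_2),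
    similarity k f /\ [/\ f A = D, f B = E & f C = F].

(* Main.v *)
Require Import Defs.
From mathcomp Require Import all_boot all_order all_algebra.
From mathcomp Require Import classical_sets reals.
From mathcomp Require Import ring lra.
Import Order.TTheory GRing.Theory Num.Theory.
Set Implicit Arguments.
Unset Strict Implicit.
Unset Printing Implicit Defensive.
Local Open Scope classical_set_scope.
Local Open Scope ring_scope.

(** Write [u = B - A], [v = C - A], [p = E - D], [q = F - D].  Subtracting the
    linear equations that define [D], [E] and [F] gives the four products
    [<p,u> = <u,v> - |u|^2/2], [<p,v> = <q,u> = (|v|^2 - |u|^2)/2] and
    [<q,v> = |v|^2/2 - <u,v>].  Hence the linear map [S] with [S u = p] and
    [S v = q] is symmetric, because [<S u,v> = <u,S v>], and traceless, because
    [|u|^2 <S v,v> - 2 <u,v> <S u,v> + |v|^2 <S u,u> = 0] and the left side is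
    the trace times the Gram determinant of [u] and [v].  In the plane a
    symmetric traceless matrix is a scaled reflection, so
    [X |-> D + S (X - A)] is a similarity, reversing orientation, as soon as
    [S] is nonzero.  If [S = 0] then [p = 0], and the first two products give
    [|u|^2 = |v|^2 = 2 <u,v>]: the triangle is equilateral.

    The proof takes [S] to be the scaled reflection sending [u] to [p]
    ([refl_scaling_exists]) and gets [S v = q] by comparing inner products with
    [u] and [v] ([eq_of_dot]), the one with [v] coming from the trace identity
    ([refl_scaling_trace]). *)

Lemma dotE (R : realType) (x y : 'rV[R]_2) :
  dot x y = x 0 0 * y 0 0 + x 0 1 * y 0 1.
Proof.
rewrite /dot big_ord_recl big_ord1.
by congr (_ + x _ _ * y _ _); apply: val_inj.
Qed.

Lemma eq_row2 (R : realType) (x y : 'rV[R]_2) :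
  x 0 0 = y 0 0 -> x 0 1 = y 0 1 -> x = y.
Proof.
move=> h0 h1; apply/rowP => i.
by case: (unliftP 0 i) => [j|] -> //; rewrite (ord1 j) (_ : lift 0 0 = 1) //;
  apply: val_inj.
Qed.

Lemma dot_self_neq0 (R : realType) (x : 'rV[R]_2) : x != 0 -> dot x x != 0.
Proof.
apply: contraNneq; rewrite dotE => h.
by apply/eqP/eq_row2; rewrite [RHS]mxE; nra.
Qed.

(** The signed area of the parallelogram on [x] and [y]. *)
Definition cross (R : realType) (x y : 'rV[R]_2) : R :=
  x 0 0 * y 0 1 - x 0 1 * y 0 0.

Lemma collinear_of_cross (R : realType) (A B C : 'rV[R]_2) :
  cross (B - A) (C - A) = 0 -> collinear A B C.
Proof.
have [/eqP|u0 uv] := eqVneq (B - A) 0.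
  rewrite subr_eq0 => /eqP -> _.
  have [->|CA] := eqVneq C A.
    (* All three points coincide: any line through A will do. *)
    exists A, (A + const_mx 1); split; try by exists 0; rewrite scale0r addr0.
    move=> /rowP /(_ 0); rewrite !mxE => h; lra.
  exists A, C; split; try by exists 0; rewrite scale0r addr0.
    by move=> e; rewrite e eqxx in CA.
  by exists 1; rewrite scale1r addrC subrK.
have a0 := dot_self_neq0 u0.
exists A, B; split.
- by move=> e; rewrite e subrr eqxx in u0.
- by exists 0; rewrite scale0r addr0.
- by exists 1; rewrite scale1r addrC subrK.
(* C is A plus the orthogonal projection of C - A on the direction B - A. *)
exists (dot (B - A) (C - A) / dot (B - A) (B - A)).
rewrite -[LHS](subrK A) addrC; congr (_ + _).
move: (B - A) (C - A) a0 uv => u v.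
rewrite /cross !dotE => a0 uv.
(* After clearing the denominator, the two sides differ by a multiple of the
   cross product. *)
have cr c : c * (u 0 0 * v 0 1 - u 0 1 * v 0 0) = 0 by rewrite uv mulr0.
apply: eq_row2; rewrite !mxE; apply: (mulIf a0); rewrite [RHS]mulrAC divfK //.
  by have := cr (u 0 1); lra.
by have := cr (u 0 0); lra.
Qed.

Lemma eq_of_dot (R : realType) (u v x y : 'rV[R]_2) : cross u v != 0 ->
  dot x u = dot y u -> dot x v = dot y v -> x = y.
Proof.
move=> uv; rewrite !dotE => hu hv.
have eu c := congr1 ( *%R c) hu; have ev c := congr1 ( *%R c) hv.
(* Cramer's rule for the difference x - y. *)
apply: eq_row2; apply: (mulIf uv); rewrite /cross.
  by have := eu (v 0 1); have := ev (u 0 1); lra.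
by have := eu (v 0 0); have := ev (u 0 0); lra.
Qed.

(** Multiplication by the symmetric traceless matrix with rows [(m, n)] and
    [(n, -m)]: a reflection in a line through the origin followed by scaling by
    [sqrt (m^2 + n^2)]. *)
Definition refl_scaling (R : realType) (m n : R) (x : 'rV[R]_2) : 'rV[R]_2 :=
  \row_i (if i == 0 then m * x 0 0 + n * x 0 1 else n * x 0 0 - m * x 0 1).

Lemma refl_scaling0E (R : realType) (m n : R) (x : 'rV[R]_2) :
  refl_scaling m n x 0 0 = m * x 0 0 + n * x 0 1.
Proof. by rewrite mxE. Qed.

Lemma refl_scaling1E (R : realType) (m n : R) (x : 'rV[R]_2) :
  refl_scaling m n x 0 1 = n * x 0 0 - m * x 0 1.
Proof. by rewrite mxE. Qed.

Definition refl_scalingE := (refl_scaling0E, refl_scaling1E).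

Lemma refl_scalingB (R : realType) (m n : R) (x y : 'rV[R]_2) :
  refl_scaling m n x - refl_scaling m n y = refl_scaling m n (x - y).
Proof.
apply: eq_row2; rewrite refl_scalingE [LHS]mxE [X in _ + X]mxE;
  by rewrite !refl_scalingE !mxE; ring.
Qed.

Lemma refl_scaling_sym (R : realType) (m n : R) (x y : 'rV[R]_2) :
  dot (refl_scaling m n x) y = dot (refl_scaling m n y) x.
Proof. by rewrite !dotE !refl_scalingE; ring. Qed.

(** For a symmetric matrix the left side minus the right side is the trace
    times the Gram determinant of [x] and [y]; here the trace vanishes. *)
Lemma refl_scaling_trace (R : realType) (m n : R) (x y : 'rV[R]_2) :
  dot x x * dot (refl_scaling m n y) y + dot y y * dot (refl_scaling m n x) x
  = 2 * dot x y * dot (refl_scaling m n x) y.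
Proof. by rewrite !dotE !refl_scalingE; ring. Qed.

Lemma dot_refl_scaling (R : realType) (m n : R) (x : 'rV[R]_2) :
  dot (refl_scaling m n x) (refl_scaling m n x) = (m ^+ 2 + n ^+ 2) * dot x x.
Proof. by rewrite !dotE !refl_scalingE; ring. Qed.

(** In complex notation [refl_scaling] is [x |-> (m + i n) * conj x], so the
    coefficient must be [p / conj x = p * x / |x|^2]. *)
Lemma refl_scaling_exists (R : realType) (x p : 'rV[R]_2) :
  x != 0 -> exists m n : R, refl_scaling m n x = p.
Proof.
move=> /dot_self_neq0; rewrite dotE => x0.
exists ((p 0 0 * x 0 0 - p 0 1 * x 0 1) / (x 0 0 * x 0 0 + x 0 1 * x 0 1)).
exists ((p 0 0 * x 0 1 + p 0 1 * x 0 0) / (x 0 0 * x 0 0 + x 0 1 * x 0 1)).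
by apply: eq_row2; rewrite refl_scalingE; field.
Qed.

Lemma similarity_refl_scaling (R : realType) (m n : R) (A D : 'rV[R]_2) :
  0 < m ^+ 2 + n ^+ 2 ->
  similarity (Num.sqrt (m ^+ 2 + n ^+ 2))
    (fun X => D + refl_scaling m n (X - A)).
Proof.
move=> mn; split=> [|P Q]; first by rewrite sqrtr_gt0.
rewrite /dist.
have -> : D + refl_scaling m n (Q - A) - (D + refl_scaling m n (P - A))
    = refl_scaling m n (Q - P).
  by rewrite opprD addrACA subrr add0r refl_scalingB opprB addrA subrK.
by rewrite dot_refl_scaling sqrtrM // ltW.
Qed.

Theorem theorem1 (R : realType) (A B C D E F : 'rV[R]_2)
  (nondegenerate : ~ collinear A B C)
  (not_equilateral : ~ equilateral A B C)
  (hD : (perp_line B A C `&` perp_bisector A B) D)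
  (hE : (perp_line C A B `&` perp_bisector B C) E)
  (hF : (perp_line A B C `&` perp_bisector A C) F) :
  similar_triangles A B C D E F.
Proof.
have uv : cross (B - A) (C - A) != 0.
  by apply/eqP => /collinear_of_cross.
have u0 : B - A != 0.
  by apply: contraNneq uv => ->; rewrite /cross !mxE; apply/eqP; ring.
have pu : dot (E - D) (B - A)
    = dot (B - A) (C - A) - dot (B - A) (B - A) / 2.
  move: (hD.2) (hE.1); rewrite /perp_bisector /perp_line /midpoint /= !dotE !mxE.
  by move=> h1 h2; lra.
have pv : dot (E - D) (C - A)
    = (dot (C - A) (C - A) - dot (B - A) (B - A)) / 2.
  move: (hD.1) (hE.1) (hE.2).
  rewrite /perp_bisector /perp_line /midpoint /= !dotE !mxE.
  by move=> h1 h2 h3; lra.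
have qu : dot (F - D) (B - A)
    = (dot (C - A) (C - A) - dot (B - A) (B - A)) / 2.
  move: (hD.2) (hF.1) (hF.2).
  rewrite /perp_bisector /perp_line /midpoint /= !dotE !mxE.
  by move=> h1 h2 h3; lra.
have qv : dot (F - D) (C - A)
    = dot (C - A) (C - A) / 2 - dot (B - A) (C - A).
  move: (hD.1) (hF.2); rewrite /perp_bisector /perp_line /midpoint /= !dotE !mxE.
  by move=> h1 h2; lra.
have [m [n Su]] := refl_scaling_exists (E - D) u0.
have Sv : refl_scaling m n (C - A) = F - D.
  apply: (eq_of_dot uv); first by rewrite refl_scaling_sym Su pv qu.
  apply: (mulfI (dot_self_neq0 u0)).
  have := refl_scaling_trace m n (B - A) (C - A).
  rewrite Su pu pv qv => h; lra.
have mn : 0 < m ^+ 2 + n ^+ 2.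
  rewrite lt0r addr_ge0 ?sqr_ge0 // andbT.
  apply/eqP => mn0; apply: not_equilateral.
  have p0 : E - D = 0.
    apply/eqP; apply/negPn/negP => /dot_self_neq0.
    by rewrite -Su dot_refl_scaling mn0 mul0r eqxx.
  move: pu pv; rewrite p0 /equilateral /dist !dotE !mxE => h1 h2.
  by split; congr Num.sqrt; lra.
exists (Num.sqrt (m ^+ 2 + n ^+ 2)), (fun X => D + refl_scaling m n (X - A)).
split; first exact: similarity_refl_scaling.
split; last 2 first.
- by rewrite Su addrC subrK.
- by rewrite Sv addrC subrK.
by apply: eq_row2; rewrite mxE refl_scalingE !mxE; ring.
Qed.
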